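(* Let $1<p<\infty$, let $\Omega\subsetneq\mathbb{R}^N$ be a domain with inradius $0<\rho\le\infty$, and let $0<R\le\infty$ be such that $\rho<R$ when $\rho<\infty$ and $R=\infty$ when $\rho=\infty$. Suppose $(V,W)$ is a $p$-Bessel pair on $(0,R)$ with positive solution $\varphi$. Then, for $u\in C_0^\infty(\Omega)$, $$\int_\Omega V(d_\Omega)|\nabla u|^pdx-\int_\Omega W(d_\Omega)|u|^pdx=\int_\Omega V(d_\Omega)\,C_p\!\left(\nabla u,\ \varphi(d_\Omega)\nabla\!\left(\frac{u}{\varphi(d_\Omega)}\right)\right)dx-\left\langle\Delta d_\Omega,\ V(d_\Omega)\left|\frac{\varphi'(d_\Omega)}{\varphi(d_\Omega)}\right|^{p-2}\frac{\varphi'(d_\Omega)}{\varphi(d_\Omega)}|u|^p\right\rangle$$ and $$\int_\Omega V(d_\Omega)|\nabla d_\Omega\cdot\nabla u|^pdx-\int_\Omega W(d_\Omega)|u|^pdx=\int_\Omega V(d_\Omega)\,C_p\!\left(\nabla d_\Omega\cdot\nabla u,\ \varphi(d_\Omega)\nabla d_\Omega\cdot\nabla\!\left(\frac{u}{\varphi(d_\Omega)}\right)\right)dx-\left\langle\Delta d_\Omega,\ V(d_\Omega)\left|\frac{\varphi'(d_\Omega)}{\varphi(d_\Omega)}\right|^{p-2}\frac{\varphi'(d_\Omega)}{\varphi(d_\Omega)}|u|^p\right\rangle .$$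
   Context: $d_\Omega(x)=\operatorname{dist}(x,\partial\Omega)$ for $x\in\Omega$; the inradius of $\Omega$ is $\sup_\Omega d_\Omega$. $\nabla d_\Omega$ exists almost everywhere ($d_\Omega$ is Lipschitz). For $0<R\le\infty$ and $1<p<\infty$, a pair $(V,W)$ of positive $C^1$ functions on $(0,R)$ is a $p$-Bessel pair on $(0,R)$ if the ODE $(V|y'|^{p-2}y')'+W|y|^{p-2}y=0$ has a positive $C^1$ solution $\varphi$ on $(0,R)$; such a $\varphi$ is called a positive solution of the pair. Convention: if $1<p<2$, $\varphi'$ is assumed to have constant sign on $(0,R)$. For $x,y\in\mathbb{R}^k$, $k\ge1$, $C_p(x,y)=|x|^p-|x-y|^p-p|x-y|^{p-2}(x-y)\cdot y$. $\Delta d_\Omega$ is the distributional Laplacian: $\langle\Delta d_\Omega,\psi\rangle=\int_\Omega d_\Omega\Delta\psi\,dx=-\int_\Omega\nabla d_\Omega\cdot\nabla\psi\,dx$ for $\psi\in C_0^\infty(\Omega)$; since $d_\Omega$ is Lipschitz, the last expression defines the pairing for compactly supported Lipschitz $\psi$. *)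

(* Defs.v *)
From HB Require Import structures.
From mathcomp Require Import all_boot all_order all_algebra.
From mathcomp Require Import all_classical all_reals all_analysis.

Set Implicit Arguments.
Unset Strict Implicit.
Unset Printing Implicit Defensive.

Import Order.TTheory GRing.Theory Num.Theory.
Import numFieldTopology.Exports numFieldNormedType.Exports.

Local Open Scope classical_set_scope.
Local Open Scope ring_scope.

(* R^N is 'rV[R]_N. Its library norm is the sup norm: it is only used through
   the topology and the notion of derivative that it induces. The Euclidean
   norm is [enorm]. *)

(* The sigma-algebra on row vectors is generated by the coordinates, as the
   library does for tuples; for T = R it is the Borel sigma-algebra. *)
Section measurable_rV.
Context {d} {T : sigmaRingType d}.
Variable n : nat.

Definition rV_coord (i : 'I_n) (x : 'rV[T]_n) : T := x ord0 i.

Let rV_set0 : g_sigma_preimage rV_coord set0.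
Proof. exact: sigma_algebra0. Qed.

Let rV_setC A : g_sigma_preimage rV_coord A -> g_sigma_preimage rV_coord (~` A).
Proof. exact: sigma_algebraC. Qed.

Let rV_bigcup (F : (set 'rV[T]_n)^nat) :
  (forall i, g_sigma_preimage rV_coord (F i)) ->
  g_sigma_preimage rV_coord (\bigcup_i (F i)).
Proof. exact: sigma_algebra_bigcup. Qed.

HB.instance Definition _ := @isMeasurable.Build (measure_tuple_display d)
  'rV[T]_n (g_sigma_preimage rV_coord) rV_set0 rV_setC rV_bigcup.

End measurable_rV.

Section lebesgue_rV.
Context {R : realType}.

Lemma measurable_rV_coord n (i : 'I_n) :
  measurable_fun setT (@rV_coord _ R n i).
Proof.
move=> _ Y mY; rewrite setTI; apply: sub_sigma_algebra => /=.
rewrite -bigcup_seq/=; exists i => /=; first by rewrite mem_index_enum.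
by exists Y => //; rewrite setTI.
Qed.

Lemma measurable_to_rV d (T : measurableType d) n (f : T -> 'rV[R]_n) :
  (forall i, measurable_fun setT (rV_coord i \o f)) -> measurable_fun setT f.
Proof.
move=> mf _ A mA.
have : preimage_set_system setT f (g_sigma_preimage (@rV_coord _ R n)) (setT `&` f @^-1` A).
  by exists A.
rewrite -g_sigma_preimage_comp; move: (setT `&` _).
apply: smallest_sub; first exact: sigma_algebra_measurable.
rewrite -bigcup_seq/=; apply: bigcup_sub => i _ _ [B mB <-].
exact: mf.
Qed.

Definition rV_cons n (z : R * 'rV[R]_n) : 'rV[R]_n.+1 :=
  \row_i (if unlift ord0 i is Some j then z.2 ord0 j else z.1).

Definition rV_uncons n (x : 'rV[R]_n.+1) : R * 'rV[R]_n :=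
  (x ord0 ord0, \row_j x ord0 (lift ord0 j)).

Lemma rV_consK n : cancel (@rV_cons n) (@rV_uncons n).
Proof.
case=> a v; rewrite /rV_uncons mxE unlift_none; congr pair.
by apply/rowP => j; rewrite !mxE liftK.
Qed.

Lemma rV_unconsK n : cancel (@rV_uncons n) (@rV_cons n).
Proof.
move=> x; apply/rowP => i; rewrite mxE.
by case: unliftP => [j|] -> //; rewrite mxE.
Qed.

Lemma measurable_rV_cons n : measurable_fun setT (@rV_cons n).
Proof.
apply: measurable_to_rV => i.
case: (unliftP ord0 i) => [j|] ->.
  rewrite (_ : _ \o _ = rV_coord j \o snd); last first.
    by apply/funext => z /=; rewrite /rV_coord mxE liftK.
  by apply: measurableT_comp => //; exact: measurable_rV_coord.
rewrite (_ : _ \o _ = fst) //.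
by apply/funext => z /=; rewrite /rV_coord mxE unlift_none.
Qed.

Lemma measurable_rV_uncons n : measurable_fun setT (@rV_uncons n).
Proof.
apply/measurable_fun_pairP; split; first exact: (measurable_rV_coord ord0).
apply: measurable_to_rV => j.
rewrite (_ : _ \o _ = rV_coord (lift ord0 j)); first exact: measurable_rV_coord.
by apply/funext => x /=; rewrite /rV_coord mxE.
Qed.

Section step.
Variables (n : nat) (mu : {sigma_finite_measure set 'rV[R]_n -> \bar R}).

Definition lebesgue_step : set 'rV[R]_n.+1 -> \bar R :=
  pushforward (lebesgue_measure \x mu)%E (@rV_cons n).

Let step0 : lebesgue_step set0 = 0%E.
Proof. by rewrite /lebesgue_step /pushforward preimage_set0 measure0. Qed.

Let step_ge0 A : (0 <= lebesgue_step A)%E.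
Proof. exact: (measure_ge0 (lebesgue_measure \x mu)%E). Qed.

Let step_sigma_additive : semi_sigma_additive lebesgue_step.
Proof.
move=> F mF tF mUF.
have h : measurable_fun setT (@rV_cons n) by exact: measurable_rV_cons.
rewrite /lebesgue_step /pushforward preimage_bigcup.
apply: measure_semi_sigma_additive.
- by move=> k; rewrite -[X in measurable X]setTI; exact: h.
- apply/trivIsetP => /= i j _ _ ij; rewrite -preimage_setI.
  by move/trivIsetP : tF => /(_ _ _ _ _ ij) ->//; rewrite preimage_set0.
- by rewrite -preimage_bigcup -[X in measurable X]setTI; exact: h.
Qed.

HB.instance Definition _ := isMeasure.Build _ _ _
  lebesgue_step step0 step_ge0 step_sigma_additive.

Let step_sigma_finite : sigma_finite setT lebesgue_step.
Proof.
have /sigma_finiteP[F [TF ndF Foo]] := sigma_finiteT (@lebesgue_measure R).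
have /sigma_finiteP[G [TG ndG Goo]] := sigma_finiteT mu.
exists (fun k => @rV_uncons n @^-1` (F k `*` G k)).
  rewrite -preimage_bigcup; apply/esym; rewrite -subTset => x _.
  have [[i _ Fi] [j _ Gj]] : (\bigcup_k F k) (rV_uncons x).1 /\
      (\bigcup_k G k) (rV_uncons x).2 by rewrite -TF -TG.
  exists (maxn i j) => //; split => /=.
  - by move: Fi; exact/subsetPset/ndF/leq_maxl.
  - by move: Gj; exact/subsetPset/ndG/leq_maxr.
move=> k; have [mF ?] := Foo k; have [mG ?] := Goo k; split.
  rewrite -[X in measurable X]setTI; apply: measurable_rV_uncons => //.
  exact: measurableX.
rewrite /lebesgue_step /pushforward -comp_preimage.
rewrite (_ : _ \o _ = id) ?preimage_id; last first.
  by apply/funext => z /=; rewrite rV_consK.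
by rewrite product_measure1E// lte_mul_pinfty// ge0_fin_numE.
Qed.

HB.instance Definition _ := Measure_isSigmaFinite.Build _ _ _
  lebesgue_step step_sigma_finite.

End step.

Fixpoint lebesgue_rV n : {sigma_finite_measure set 'rV[R]_n -> \bar R} :=
  match n with
  | 0 => \d_ (0 : 'rV[R]_0)
  | m.+1 => lebesgue_step (lebesgue_rV m)
  end.

Lemma lebesgue_rV_box n (A : 'I_n -> set R) : (forall i, measurable (A i)) ->
  lebesgue_rV n [set x | forall i, A i (x ord0 i)] =
  (\prod_(i < n) lebesgue_measure (A i))%E.
Proof.
elim: n A => [|n IH] A mA.
  by rewrite big_ord0 /= diracE mem_set//=; case.
rewrite big_ord_recl -IH; last by move=> i; exact: mA.
have mB : measurable [set x : 'rV[R]_n | forall i, A (lift ord0 i) (x ord0 i)].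
  rewrite (_ : mkset _ = \bigcap_(i in [set: 'I_n]) (rV_coord i @^-1` A (lift ord0 i))).
    apply: fin_bigcap_measurable => // i _.
    by rewrite -[X in measurable X]setTI; exact: measurable_rV_coord.
  by apply/seteqP; split => [x h i _|x h i]; exact: h.
rewrite -(product_measure1E lebesgue_measure (lebesgue_rV n) (mA ord0) mB) /=.
rewrite /lebesgue_step /pushforward; congr (product_measure1 _ _ _).
apply/seteqP; split => -[a v] /=.
  move=> h; split=> [|i]; first by have := h ord0; rewrite mxE unlift_none.
  by have := h (lift ord0 i); rewrite mxE liftK.
by move=> [ha hv] i; rewrite mxE; case: unliftP => [j|] ->.
Qed.

End lebesgue_rV.

Section euclidean.
Context {R : realType} {n : nat}.
Implicit Types (x y : 'rV[R]_n) (f : 'rV[R]_n -> R) (A : set 'rV[R]_n).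

Definition edot x y : R := \sum_(i < n) x ord0 i * y ord0 i.

Definition enorm x : R := Num.sqrt (edot x x).

Definition partial (i : 'I_n) f : 'rV[R]_n -> R := 'D_(delta_mx ord0 i) f.

(* The partial derivatives take an arbitrary value where they do not exist; this
   is harmless under an integral when f is locally Lipschitz. *)
Definition grad f x : 'rV[R]_n := \row_i partial i f x.

Definition smooth f := forall s : seq 'I_n,
  continuous (foldr partial f s) /\
  forall i x, derivable (foldr partial f s) x (delta_mx ord0 i).

Definition test_function A f :=
  [/\ smooth f, compact (closure [set x | f x != 0])
    & closure [set x | f x != 0] `<=` A].

Definition domain A := [/\ A !=set0, open A & connected A].

Definition boundary A := closure A `\` A°.

(* On all of R^n; only the values in A matter. *)
Definition dist_boundary A x : R := inf [set enorm (x - y) | y in boundary A].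

Definition inradius A : \bar R := ereal_sup [set (dist_boundary A x)%:E | x in A].

(* <Delta d_A, psi> for compactly supported Lipschitz psi. *)
Definition laplacian_dist A (psi : 'rV[R]_n -> R) : \bar R :=
  (- \int[lebesgue_rV n]_(x in A) (edot (grad (dist_boundary A) x) (grad psi x))%:E)%E.

(* At x = y and p < 2 the middle factor is 0 `^ (p - 2) = 0, so that
   |z|^(p-2) z is read as 0 at z = 0. *)
Definition Cp (p : R) x y : R :=
  enorm x `^ p - enorm (x - y) `^ p - p * enorm (x - y) `^ (p - 2) * edot (x - y) y.

End euclidean.

Section bessel.
Context {R : realType}.
Implicit Types (p : R) (b : \bar R) (f V W phi : R -> R).

Definition itv0 b : set R := [set t | 0 < t /\ (t%:E < b)%E].

Definition C1_on (I : set R) f :=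
  forall t, I t -> derivable f t 1 /\ {for t, continuous (derive1 f)}.

Definition positive_on (I : set R) f := forall t, I t -> 0 < f t.

(* |s|^(p-2) s *)
Definition ppow p (s : R) : R := `|s| `^ (p - 2) * s.

(* The last clause is the standing convention for 1 < p < 2; constant sign is
   understood in the weak sense. *)
Definition positive_solution p b V W phi :=
  [/\ positive_on (itv0 b) phi, C1_on (itv0 b) phi,
      forall t, itv0 b t ->
        let flux := fun s => V s * ppow p (derive1 phi s) in
        derivable flux t 1 /\ derive1 flux t + W t * ppow p (phi t) = 0
    & p < 2 -> (forall t, itv0 b t -> 0 <= derive1 phi t) \/
               (forall t, itv0 b t -> derive1 phi t <= 0)].

Definition bessel_pair p b V W :=
  [/\ positive_on (itv0 b) V, positive_on (itv0 b) W,
      C1_on (itv0 b) V, C1_on (itv0 b) W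
    & exists phi, positive_solution p b V W phi].

End bessel.

(* Main.v *)
Require Import Defs.
From mathcomp Require Import all_boot all_order all_algebra.
From mathcomp Require Import all_classical all_reals all_analysis.
From mathcomp Require Import measurable_realfun ring lra.

Set Implicit Arguments.
Unset Strict Implicit.
Unset Printing Implicit Defensive.

Import Order.TTheory GRing.Theory Num.Theory.
Import numFieldTopology.Exports numFieldNormedType.Exports.

Local Open Scope classical_set_scope.
Local Open Scope ring_scope.

(** Put q := phi' / phi and G := V |q|^(p-2) q, so that the function paired with
the Laplacian is psi = G(d) |u|^p. Both identities hold before integration, at
almost every point; no integration by parts takes place, because the pairing
with the Laplacian is by definition minus the integral of grad d . grad psi.

At a point where d has all its partial derivatives and |grad d| = 1, the product
rule gives phi(d) grad (u / phi(d)) = grad u - c grad d with c = u q(d). As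
|grad d| = 1, expanding C_p leaves
<<
   |grad u|^p + (p-1) |c|^p - p |c|^(p-2) c (grad d . grad u)
>>
([Cp_sub]). On the other side the differential equation for phi becomes the
Riccati equation G' = - W - (p-1) V |q|^p ([is_derive_riccati]), hence
<<
   grad d . grad psi = - (W + (p-1) V |q|^p) |u|^p
                       + p V |q|^(p-2) q |u|^(p-2) u (grad d . grad u).
>>
In the sum of V times the first expression and the second one, all the terms
cancel but V |grad u|^p - W |u|^p ([hardy_vector]). The second identity is the
same computation for the real numbers grad d . grad u and c ([hardy_scalar]).

Almost every point of Omega is of this kind, for a reason simpler than
Rademacher's theorem. The function |x|^2 - d(x)^2 is a supremum of affine
functions of x, so it is convex on each line, and a convex function of one
variable is differentiable outside a countable set
([convex_derivable_countable]). A measurable set whose lines in one coordinate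
direction are all countable is null, by Tonelli's theorem
([lebesgue_rV_countable_lines]). Where the i-th partial derivative of d does
exist, comparison of d with the distance to a nearest boundary point y forces it
to be the i-th coordinate of (x - y) / d(x) ([partial_dist]); so |grad d| = 1 as
soon as all of them exist ([edot_grad_dist]).

Integration of the pointwise identity is legitimate since every integral but the
one of C_p has an integrand dominated almost everywhere by a continuous function
that vanishes outside the support of u ([compact_support_integrable]); the
remaining one is measurable and agrees with a combination of the others
([integral_balance]). Measurability of gradients extended arbitrarily to points
of non-differentiability comes from [measurable_derive]. *)

(** * Borel measurability in R^n *)

Section measurability_rV.
Context {R : realType}.

(** The sigma-algebra generated by the coordinates contains the open sets because
an open set is the union of the countably many rational cubes inside it. *)
Lemma open_measurable_rV n (O : set 'rV[R]_n) : open O -> measurable O.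
Proof.
move=> oO.
pose B (qk : 'rV[rat]_n * nat) : set 'rV[R]_n :=
  @ball R 'rV[R]_n (map_mx ratr qk.1) (qk.2.+1%:R^-1).
have mB qk : measurable (B qk).
  rewrite (_ : B qk = \bigcap_(i in [set: 'I_n])
     (rV_coord i @^-1` ball (map_mx ratr qk.1 ord0 i : R) qk.2.+1%:R^-1)).
    apply: fin_bigcap_measurable => // i _.
    rewrite -[X in measurable X]setTI; apply: measurable_rV_coord => //.
    apply: open_measurable; exact: ball_open.
  apply/seteqP; split => x.
    by case=> _ xB i _; exact: xB.
  move=> xB; split => // i j; rewrite ord1; exact: (xB j).
pose S : set ('rV[rat]_n * nat) := [set qk | B qk `<=` O].
rewrite (_ : O = \bigcup_(qk in S) B qk).
  rewrite bigcup_mkcond; apply: countable_bigcupT_measurable; first exact: countableP.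
  by move=> qk; case: ifP.
apply/seteqP; split => [x Ox|x [qk]]; last exact.
have /nbhs_ballP[e /= e0 xe] : nbhs x O by exact: open_nbhs_nbhs.
have [k ke] : exists k, 2 * k.+1%:R^-1 < e.
  have [k] := @ltr_add_invr R 0 (e / 2) (divr_gt0 e0 (ltr0Sn _ _)).
  rewrite add0r ltr_pdivlMr// mulrC => ke; by exists k.
have k0 : 0 < k.+1%:R^-1 :> R by rewrite invr_gt0.
have [q xq] : exists q : 'rV[rat]_n, forall i, `|x ord0 i - ratr (q ord0 i)| < k.+1%:R^-1.
  have H (i : 'I_n) : {r : rat | `|x ord0 i - ratr r| < k.+1%:R^-1}.
    apply: cid.
    have /rat_in_itvoo[r] : x ord0 i - k.+1%:R^-1 < x ord0 i + k.+1%:R^-1.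
      by rewrite ltrBlDr -addrA ltrDl addr_gt0.
    rewrite in_itv/= => /andP[r1 r2]; exists r.
    by rewrite distrC ltr_distl r1.
  exists (\row_i projT1 (H i)) => i; rewrite mxE; exact: (projT2 (H i)).
exists (q, k).
  move=> y [_ qy]; apply: xe; split => // i j; rewrite ord1 in qy *.
  have := qy ord0 j; rewrite mxE /ball/= => h.
  apply: le_lt_trans ke.
  rewrite mulr_natl mulr2n (le_trans (ler_distD (ratr (q ord0 j)) _ _))//.
  by rewrite lerD// ltW.
split => // i j; rewrite ord1 mxE /ball/= distrC; exact: xq.
Qed.

Lemma closed_measurable_rV n (C : set 'rV[R]_n) : closed C -> measurable C.
Proof.
move=> cC; rewrite -[C]setCK.
by apply: measurableC; apply: open_measurable_rV; exact: closed_openC.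
Qed.

Lemma continuous_measurable_rV n (A : set 'rV[R]_n) (f : 'rV[R]_n -> R) :
  open A -> (forall x, A x -> {for x, continuous f}) -> measurable_fun A f.
Proof.
move=> oA cf; apply: (measurability _ (RGenOpens.measurableE R)).
move=> _ [_ [a [b ->] <-]]; apply: open_measurable_rV.
rewrite openE => x [Ax fx]; apply: filterI; first exact: open_nbhs_nbhs.
by apply: (cf x Ax); apply: open_nbhs_nbhs; split => //; exact: interval_open.
Qed.

End measurability_rV.

Lemma closed_dist_le {R : realType} (T : topologicalType) (f g : T -> R) (c : R) :
  continuous f -> continuous g -> closed [set x | `|f x - g x| <= c].
Proof.
move=> cf cg.
apply: (@preimage_closed _ _ (fun x => `|f x - g x|) [set t | t <= c]).
  by move=> x _; apply: cvg_norm; apply: cvgB; [exact: cf|exact: cg].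
exact: closed_le.
Qed.

Lemma continuous_growth_rate {R : realType} (V : normedModType R) (f : V -> R)
    (v : V) (h : R) :
  continuous f -> continuous (fun x => h^-1 *: (f (h *: v + x) - f x)).
Proof.
move=> cf x; apply: cvgMl_tmp; apply: cvgB; last exact: cf.
apply: continuous_comp; last exact: cf.
by apply: cvgD; [exact: cvg_cst|exact: cvg_id].
Qed.

Section partial_measurable.
Context {R : realType} {n : nat}.
Variables (f : 'rV[R]_n -> R) (v : 'rV[R]_n).
Hypothesis cf : continuous f.

Let Q (h : R) x : R := h^-1 *: (f (h *: v + x) - f x).

Let cQ h : continuous (Q h).
Proof. exact: continuous_growth_rate. Qed.

(* Cauchy criterion for the difference quotients at x; each such set is closed,
   as an intersection of closed conditions over all pairs of increments. *)
Let D k m : set 'rV[R]_n := [set x | forall r s : R, 0 < `|r| < m.+1%:R^-1 ->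
  0 < `|s| < m.+1%:R^-1 -> `|Q r x - Q s x| <= k.+1%:R^-1].

Let closedD k m : closed (D k m).
Proof.
rewrite (_ : D k m = \bigcap_(rs in [set rs : R * R | 0 < `|rs.1| < m.+1%:R^-1
   /\ 0 < `|rs.2| < m.+1%:R^-1])
   ((fun x => `|Q rs.1 x - Q rs.2 x|) @^-1` [set t | t <= k.+1%:R^-1])).
  apply: closed_bigI => -[r s] _; exact: closed_dist_le.
apply/seteqP; split => x /= h; first by move=> [r s] [/= ? ?]; exact: h.
by move=> r s ? ?; exact: (h (r, s)).
Qed.

Let derivableE : [set x | derivable f x v] = \bigcap_k \bigcup_m D k m.
Proof.
apply/seteqP; split => x /=.
  move=> /cvg_cauchy/cauchy_ballP df k _.
  have /df : 0 < k.+1%:R^-1 :> R by rewrite invr_gt0.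
  move=> [[A B] /= [A0 B0] AB].
  have /nbhs_ballP[e /= e0 he] : nbhs (0:R) (fun h => h != 0 -> A (Q h x) /\ B (Q h x)).
    exact: (filterI A0 B0).
  have [m me] := ltr_add_invr e0; rewrite add0r in me.
  exists m => // r s /andP[r0 rm] /andP[s0 sm].
  have [Ar _] : A (Q r x) /\ B (Q r x).
    apply: he; last by rewrite -normr_gt0.
    by rewrite /ball/= sub0r normrN (lt_trans rm).
  have [_ Bs] : A (Q s x) /\ B (Q s x).
    apply: he; last by rewrite -normr_gt0.
    by rewrite /ball/= sub0r normrN (lt_trans sm).
  exact/ltW/(AB (Q r x, Q s x)).
move=> h; apply/cauchy_cvgP/cauchy_ballP => e e0.
have [k ke] := ltr_add_invr e0; rewrite add0r in ke.
have [m _ Dx] := h k I.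
have m0 : 0 < m.+1%:R^-1 :> R by rewrite invr_gt0.
pose S := (Q ^~ x) @` [set r : R | 0 < `|r| < m.+1%:R^-1].
have FS : \forall r \near (0:R)^', S (Q r x).
  apply/nbhs_ballP; exists m.+1%:R^-1 => // r.
  rewrite /ball/= sub0r normrN => rm r0; exists r => //=.
  by rewrite normr_gt0 r0.
exists (S, S); first by split; exact: FS.
move=> [_ _] /= [[r rm <-] [s sm <-]].
exact: (le_lt_trans (Dx r s rm sm) ke).
Qed.

(** By the Cauchy criterion for difference quotients, this set is a countable
intersection of countable unions of closed sets. *)
Lemma measurable_derivable : measurable [set x | derivable f x v].
Proof.
rewrite derivableE; apply: bigcap_measurable => // k _.
by apply: bigcup_measurable => m _; exact: closed_measurable_rV.
Qed.

(** Where the derivative exists it is a limit of continuous difference quotients;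
elsewhere its value is one and the same default point. *)
Lemma measurable_derive : measurable_fun setT ('D_v f).
Proof.
have mD := measurable_derivable.
rewrite -(setUv [set x | derivable f x v]).
apply/measurable_funU => //; first exact: measurableC.
split.
  apply: (@measurable_fun_cvg _ _ _ _ (fun m => Q m.+1%:R^-1)).
    move=> m; apply: (measurable_funS (E := setT)) => //.
    apply: continuous_measurable_rV; first exact: openT.
    by move=> x _; exact: cQ.
  move=> x /= dx.
  apply: (@cvg_comp _ _ _ (fun m => m.+1%:R^-1) (fun h => Q h x) \oo 0^') => //.
  move=> A [e /= e0 he]; near=> m.
  apply: he => /=; last by rewrite invr_neq0.
  rewrite sub0r normrN gtr0_norm ?invr_gt0//; near: m.
  exact: near_infty_natSinv_lt (PosNum e0).
apply: (eq_measurable_fun (fun=> point)) => // x; rewrite inE /= => dx.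
by rewrite /derive (dvgP dx).
Unshelve. all: by end_near. Qed.

End partial_measurable.

(** * Null sets and compact sets for the Lebesgue measure of R^n *)

Section null_sets_rV.
Context {R : realType}.

Lemma rV_cons_delta0 n (t a : R) (v : 'rV[R]_n) :
  t *: delta_mx ord0 ord0 + rV_cons (a, v) = rV_cons (t + a, v).
Proof.
apply/rowP => k; rewrite !mxE eqxx/=; case: (unliftP ord0 k) => [l|] ->.
  by rewrite mulr0 add0r.
by rewrite eqxx mulr1.
Qed.

Lemma rV_cons_delta_lift n (j : 'I_n) (t a : R) (v : 'rV[R]_n) :
  t *: delta_mx ord0 (lift ord0 j) + rV_cons (a, v) =
  rV_cons (a, t *: delta_mx ord0 j + v).
Proof.
apply/rowP => k; rewrite !mxE eqxx/=; case: (unliftP ord0 k) => [l|] ->.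
  by rewrite !mxE (inj_eq lift_inj).
by rewrite mulr0 add0r.
Qed.

(** Tonelli's theorem: the measure is a product of the measure on the first
coordinate and of a measure in one dimension less. If the lines run in the first
direction, integrate over them first; otherwise slice by the first coordinate
and use induction on the dimension. *)
Lemma lebesgue_rV_countable_lines n (i : 'I_n) (B : set 'rV[R]_n) :
  measurable B ->
  (forall x, countable [set t | B (t *: delta_mx ord0 i + x)]) ->
  lebesgue_rV n B = 0%E.
Proof.
elim: n i B => [[]//|n IH] i B mB.
have mB' : measurable (@rV_cons R n @^-1` B).
  by rewrite -[X in measurable X]setTI; exact: measurable_rV_cons.
rewrite /= /lebesgue_step /pushforward.
case: (unliftP ord0 i) => [j ->|->] cB.
  rewrite /product_measure1; apply: integral0_eq => a _ /=.
  apply: (IH j); first exact: measurable_xsection.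
  move=> v; have := cB (rV_cons (a, v)); congr countable.
  apply/seteqP; split => t /=; rewrite rV_cons_delta_lift.
    by move=> ?; apply/xsectionP.
  by move=> /xsectionP.
have mu2 A1 A2 : measurable A1 -> measurable A2 ->
  (lebesgue_measure \x^ lebesgue_rV n)%E (A1 `*` A2) =
  (@lebesgue_measure R A1 * lebesgue_rV n A2)%E by exact: product_measure2E.
rewrite (product_measure_unique mu2 mB').
rewrite /product_measure2; apply: integral0_eq => v _ /=.
apply: countable_lebesgue_measure0.
have := cB (rV_cons (0, v)); congr countable.
apply/seteqP; split => t /=; rewrite rV_cons_delta0 addr0.
  by move=> ?; apply/ysectionP.
by move=> /ysectionP.
Qed.

(** A bounded set lies in a box, whose volume is a finite product of lengths. *)
Lemma lebesgue_rV_compact_lty n (K : set 'rV[R]_n) : compact K ->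
  (lebesgue_rV n K < +oo)%E.
Proof.
move=> cK; have mK : measurable K.
  by apply: closed_measurable_rV; apply: compact_closed => //; exact: norm_hausdorff.
have [M [_ KM]] := compact_bounded cK.
pose A (i : 'I_n) : set R := `[- (`|M| + 1), `|M| + 1]%classic.
have KA : K `<=` [set x | forall i, A i (x ord0 i)].
  move=> x Kx i; rewrite /A/= in_itv/= -ler_norml.
  have /le_trans : `|x ord0 i| <= `|x|; last first.
    by apply; apply: (KM (`|M| + 1)) => //; rewrite ltr_pwDr// ler_norm.
  rewrite [leRHS]/Num.norm /= mx_normrE.
  by apply/bigmax_geP; right => /=; exists (ord0, i).
have mA i : measurable (A i) by exact: measurable_itv.
have mbox : measurable [set x : 'rV[R]_n | forall i, A i (x ord0 i)].
  rewrite (_ : mkset _ = \bigcap_(i in [set: 'I_n]) (rV_coord i @^-1` A i)).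
    apply: fin_bigcap_measurable => // i _.
    by rewrite -[X in measurable X]setTI; exact: measurable_rV_coord.
  by apply/seteqP; split => [x h i _|x h i]; exact: h.
apply: (@le_lt_trans _ _ (lebesgue_rV n [set x | forall i, A i (x ord0 i)])).
  by apply: le_measure => //; rewrite inE.
rewrite lebesgue_rV_box//.
rewrite ltey_eq; apply/orP; left.
apply: (big_ind (fun z => z \is a fin_num)) => //.
  by move=> x y; exact: fin_numM.
by move=> i _; rewrite /A lebesgue_measure_itv/=; case: ifP.
Qed.

End null_sets_rV.

(** * Derivatives along lines *)

Section derive_along_lines.
Context {R : realType} {V : normedModType R}.
Implicit Types (f : V -> R) (x v : V) (t a : R).

Lemma is_derive_line f x v t a :
  is_derive t 1 (fun s : R => f (s *: v + x)) a <-> is_derive (t *: v + x) v f a.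
Proof.
have E : (fun h : R => h^-1 *:
     (((fun s : R => f (s *: v + x)) \o shift t) (h *: 1) - f (t *: v + x))) =
   (fun h : R => h^-1 *: ((f \o shift (t *: v + x)) (h *: v) - f (t *: v + x))).
  by apply/funext => h /=; rewrite [h%:A]mulr1 scalerDl addrA.
split=> -[H1 H2]; split.
- by move: H1; rewrite /derivable E.
- by move: H2; rewrite /derive E.
- by rewrite /derivable E.
- by rewrite /derive E.
Qed.

Lemma derivable_line f x v t :
  derivable (fun s : R => f (s *: v + x)) t 1 <-> derivable f (t *: v + x) v.
Proof.
split=> /derivableP d; first by have [] := (is_derive_line f x v t _).1 d.
by have [] := (is_derive_line f x v t _).2 d.
Qed.

Lemma is_derive_line0 f x v a :
  is_derive (0 : R) 1 (fun s : R => f (s *: v + x)) a <-> is_derive x v f a.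
Proof. by rewrite (is_derive_line f x v 0 a) scale0r add0r. Qed.

Lemma is_derive_comp_real (g : R -> R) f x v a b :
  is_derive (f x) 1 g b -> is_derive x v f a -> is_derive x v (g \o f) (b * a).
Proof.
move=> dg df; apply/is_derive_line0.
apply: (@is_derive1_comp _ g (fun s : R => f (s *: v + x))).
  by rewrite scale0r add0r.
exact/is_derive_line0.
Qed.

End derive_along_lines.

(** * The Euclidean inner product *)

Section euclidean_theory.
Context {R : realType} {n : nat}.
Implicit Types (x y z : 'rV[R]_n).

Lemma edotC x y : edot x y = edot y x.
Proof. by apply: eq_bigr => i _; rewrite mulrC. Qed.

Lemma edotDl x y z : edot (x + y) z = edot x z + edot y z.
Proof. by rewrite -big_split; apply: eq_bigr => i _; rewrite mxE mulrDl. Qed.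

Lemma edotZl a x y : edot (a *: x) y = a * edot x y.
Proof. by rewrite mulr_sumr; apply: eq_bigr => i _; rewrite mxE mulrA. Qed.

Lemma edotNl x y : edot (- x) y = - edot x y.
Proof. by rewrite -scaleN1r edotZl mulN1r. Qed.

Lemma edotDr x y z : edot x (y + z) = edot x y + edot x z.
Proof. by rewrite edotC edotDl !(edotC x). Qed.

Lemma edotZr a x y : edot x (a *: y) = a * edot x y.
Proof. by rewrite edotC edotZl edotC. Qed.

Lemma edotNr x y : edot x (- y) = - edot x y.
Proof. by rewrite edotC edotNl edotC. Qed.

Definition edotE := (edotDl, edotDr, edotNl, edotNr, edotZl, edotZr).

Lemma edot_delta i x : edot (delta_mx ord0 i) x = x ord0 i.
Proof.
rewrite /edot (bigD1 i)//= !mxE !eqxx mul1r big1 ?addr0// => j ji.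
by rewrite !mxE eqxx (negbTE ji) mul0r.
Qed.

Lemma edot_ge0 x : 0 <= edot x x.
Proof. by apply: sumr_ge0 => i _; rewrite -expr2 sqr_ge0. Qed.

Lemma edot_eq0 x : edot x x = 0 -> x = 0.
Proof.
move=> /eqP; rewrite psumr_eq0 => [/allP x0|i _]; last by rewrite -expr2 sqr_ge0.
apply/rowP => i; rewrite mxE; have := x0 i.
by rewrite mem_index_enum mulf_eq0 orbb => /(_ isT)/eqP.
Qed.

Lemma enorm_ge0 x : 0 <= enorm x. Proof. exact: sqrtr_ge0. Qed.

Lemma enorm_sqr x : enorm x ^+ 2 = edot x x.
Proof. by rewrite sqr_sqrtr// edot_ge0. Qed.

Lemma enormN x : enorm (- x) = enorm x.
Proof. by rewrite /enorm !edotE opprK. Qed.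

Lemma enormZ a x : enorm (a *: x) = `|a| * enorm x.
Proof.
rewrite /enorm !edotE mulrA -expr2 sqrtrM ?sqr_ge0//.
by rewrite sqrtr_sqr.
Qed.

(** Cauchy-Schwarz: expand the square of (y.y) x - (x.y) y. *)
Lemma edot_le x y : edot x y <= enorm x * enorm y.
Proof.
have [y0|yN0] := eqVneq (edot y y) 0.
  by rewrite (edot_eq0 y0) -(scale0r 0) edotZr mul0r mulr_ge0// enorm_ge0.
have y_gt0 : 0 < edot y y by rewrite lt0r yN0 edot_ge0.
have := edot_ge0 (edot y y *: x - edot x y *: y).
rewrite !edotE (edotC y x).
rewrite (_ : _ + _ = edot y y * (edot x x * edot y y - edot x y ^+ 2)); last by ring.
rewrite pmulr_rge0// subr_ge0 -!enorm_sqr -exprMn => h.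
rewrite (le_trans (ler_norm _))// -ler_sqr ?nnegrE//; last first.
  by rewrite mulr_ge0// enorm_ge0.
by rewrite real_normK// num_real.
Qed.

Lemma enormD x y : enorm (x + y) <= enorm x + enorm y.
Proof.
rewrite -ler_sqr ?nnegrE ?addr_ge0 ?enorm_ge0//.
rewrite enorm_sqr !edotE sqrrD !enorm_sqr (edotC y x).
by have := edot_le x y; lra.
Qed.

Lemma coord_le_enorm x i : `|x ord0 i| <= enorm x.
Proof.
rewrite -ler_sqr ?nnegrE ?enorm_ge0// real_normK ?num_real// enorm_sqr.
rewrite /edot (bigD1 i)//= -expr2 lerDl sumr_ge0// => j _.
by rewrite -expr2 sqr_ge0.
Qed.

End euclidean_theory.

Lemma continuous_sum_real {R : realType} {T : topologicalType} (I : Type)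
    (r : seq I) (f : I -> T -> R) x :
  (forall i, {for x, continuous (f i)}) ->
  {for x, continuous (fun x => \sum_(i <- r) f i x)}.
Proof.
move=> cf; apply: cvg_big => [|i _]; last exact: cf.
exact: add_continuous.
Qed.

(** * Convex functions of one variable *)

Section convex_line.
Context {R : realType}.
Variables (h m : R -> R).
(* The number m t is a subgradient of h at t; its existence for every t is how
   convexity of h is used. *)
Hypothesis hm : forall s t, h t + m t * (s - t) <= h s.

Let m_nd s t : s < t -> m s <= m t.
Proof.
move=> st; have := hm t s; have := hm s t => h1 h2.
have : (m s - m t) * (t - s) <= 0 by nra.
by rewrite pmulr_lle0 ?subr_gt0// subr_le0.
Qed.

Let jump := [set t | exists2 e : R, 0 < e &
  forall s r, s < t -> t < r -> e <= m r - m s].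

(* Each jump contains a rational strictly between the values of m to the left and
   those to the right; by monotonicity two jumps cannot share it. *)
Let jump_countable : countable jump.
Proof.
have H t : {q : rat | jump t ->
    (forall s, s < t -> m s < ratr q) /\ (forall r, t < r -> ratr q < m r)}.
  apply: cid; have [[e e0 et]|nt] := pselect (jump t); last by exists 0%Q.
  pose S := m @` [set s | s < t].
  have S0 : S !=set0 by exists (m (t - 1)); exists (t - 1) => //=; rewrite gtrBl.
  have Sub r : t < r -> ubound S (m r - e).
    by move=> tr _ [s /= st <-]; rewrite lerBrDr -lerBrDl; exact: et.
  have hS : has_sup S by split => //; exists (m (t + 1) - e); apply: Sub; rewrite ltrDl.
  have /rat_in_itvoo[q] : sup S < sup S + e by rewrite ltrDl.
  rewrite in_itv/= => /andP[q1 q2]; exists q => _; split => [s st|r tr].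
    by apply: le_lt_trans q1; apply: ub_le_sup; [exact: hS.2|exists s].
  apply: (lt_le_trans q2); rewrite -lerBrDr.
  by apply: ge_sup => //; exact: Sub.
apply/countable_injP; exists (fun t => choice.pickle (projT1 (H t))).
move=> s t; rewrite !inE => js jt /(pcan_inj choice.pickleK) E.
have {}E : projT1 (H s) = projT1 (H t) by [].
have [] := projT2 (H s) js; have [] := projT2 (H t) jt; rewrite E.
have [st|ts|->//] := ltgtP s t => h1 h2 h3 h4; exfalso.
- have [st1 st2] := midf_lt st.
  by have := h4 _ st1; rewrite ltNge => /negP; apply; exact/ltW/h1.
- have [st1 st2] := midf_lt ts.
  by have := h2 _ st1; rewrite ltNge => /negP; apply; exact/ltW/h3.
Qed.

(** The difference quotients of h at t lie between values of the monotone
subgradient m on either side of t, so they converge to m t unless m jumps there. *)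
Lemma convex_derivable_countable : countable [set t | ~ derivable h t 1].
Proof.
apply: sub_countable jump_countable; apply: subset_card_le => t /=.
apply: contra_notP => nj.
apply/cvg_ex; exists (m t); apply/cvgrPdist_lt => e e0.
have [s [r [st tr sre]]] : exists s, exists r, [/\ s < t, t < r & m r - m s < e].
  apply: contrapT => H; apply: nj; exists e => // s r st tr.
  by rewrite leNgt; apply/negP => sre; apply: H; exists s, r.
have mst := m_nd st; have mtr := m_nd tr.
apply/nbhs_ballP; exists (Num.min (t - s) (r - t)).
  by rewrite /= lt_min !subr_gt0 st.
move=> k; rewrite /ball/= sub0r normrN lt_min => /andP[ks kr] k0.
rewrite [_%:A]mulr1 /=.
have H1 := hm (k + t) t; have H2 := hm t (k + t).
have -> : k^-1 *: (h (k + t) - h t) = (h (k + t) - h t) / k by rewrite mulrC.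
rewrite distrC ltr_norml.
have [kn|kp|k00] := ltgtP k 0; last by rewrite k00 eqxx in k0.
  have msk : m s <= m (k + t).
    by apply: m_nd; rewrite ltr0_norm// in ks; lra.
  by rewrite ltrBrDr ltrBlDr ltr_ndivlMr// ltr_ndivrMr//; apply/andP; split; nra.
have msk : m (k + t) <= m r.
  by apply: m_nd; rewrite gtr0_norm// in kr; lra.
by rewrite ltrBrDr ltrBlDr ltr_pdivlMr// ltr_pdivrMr//; apply/andP; split; nra.
Qed.

End convex_line.

(** * One-variable calculus *)

Lemma is_derive_quadratic {R : realType} (t b c : R) :
  is_derive t 1 (fun t : R => t ^+ 2 + t * b + c) (2 * t + b).
Proof.
have D1 : is_derive t 1 (fun t : R => t ^+ 2) (2 * t).
  by apply: is_derive_eq; rewrite [_%:A]mulr1 mulr_natl mulr2n.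
have D2 : is_derive t 1 (fun t : R => t * b) b.
  by apply: is_derive_eq; rewrite scaler0 add0r [_%:A]mulr1.
rewrite -[_ + b]addr0.
exact: is_deriveD.
Qed.

(** The difference quotients at t are nonnegative to its right and nonpositive to
its left. *)
Lemma is_derive_min {R : realType} (g : R -> R) (t a : R) :
  (forall s, g t <= g s) -> is_derive t 1 g a -> a = 0.
Proof.
move=> gt [dg ga]; apply/eqP; apply: contraT => a0.
have na : 0 < `|a| by rewrite normr_gt0.
have : (fun h : R => h^-1 *: ((g \o shift t) (h *: 1) - g t)) h @[h --> (0:R)^'] --> a.
  by rewrite -ga; exact: dg.
move=> /cvgrPdist_lt/(_ _ na)/nbhs_ballP[e /= e0 he].
have q s : 0 <= g s - g t by rewrite subr_ge0.
have [an|ap|a00] := ltgtP a 0; last by rewrite a00 eqxx in a0.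
- have eh : 0 < e / 2 by rewrite divr_gt0.
  have := he (e / 2); rewrite /ball/= sub0r normrN gtr0_norm// ltr_pdivrMr// mulr_natr.
  rewrite mulr2n ltrDl e0 gt_eqF// => /(_ isT isT).
  rewrite distrC ltr_norml => /andP[_]; rewrite ltr0_norm// ltrBlDr addNr ltNge => /negP[].
  by rewrite mulr_ge0// invr_ge0 ltW.
- have eh : - (e / 2) < 0 by rewrite oppr_lt0 divr_gt0.
  have := he (- (e / 2)); rewrite /ball/= sub0r normrN ltr0_norm// opprK ltr_pdivrMr// mulr_natr.
  rewrite mulr2n ltrDl e0 lt_eqF// => /(_ isT isT).
  rewrite ltr_norml => /andP[_]; rewrite gtr0_norm// ltrBlDr ltrDl ltNge => /negP[].
  by rewrite mulr_le0_ge0// invr_le0 ltW.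
Qed.

(** * The distance to a closed set *)

Section continuity_euclidean.
Context {R : realType} {n : nat} {T : topologicalType}.

Lemma continuousB_cst (f : T -> R) (c : R) :
  continuous f -> continuous (fun z => f z - c).
Proof. by move=> cf z; apply: cvgB; [exact: cf|exact: cvg_cst]. Qed.

Lemma continuous_edot (f g : T -> 'rV[R]_n) :
  (forall i, continuous (fun z => f z ord0 i)) ->
  (forall i, continuous (fun z => g z ord0 i)) ->
  continuous (fun z => edot (f z) (g z)).
Proof.
move=> cf cg x; apply: continuous_sum_real => i.
by apply: continuousM; [exact: cf|exact: cg].
Qed.

Lemma continuous_enorm (f : T -> 'rV[R]_n) :
  (forall i, continuous (fun z => f z ord0 i)) ->
  continuous (fun z => enorm (f z)).
Proof.
move=> cf x.
apply: (@continuous_comp _ _ _ (fun x => edot (f x) (f x)) Num.sqrt).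
  exact: continuous_edot.
exact: sqrt_continuous.
Qed.

Lemma continuous_modulus (f : T -> R) (g : T -> T -> R) :
  (forall x, continuous (g x)) -> (forall x, g x x = 0) ->
  (forall x z, `|f x - f z| <= g x z) -> continuous f.
Proof.
move=> cg g0 fg x; apply/cvgrPdist_le => e e0.
have /cvgrPdist_le/(_ _ e0) := cg x x; apply: filterS => z.
rewrite g0 sub0r normrN => /(le_trans (ler_norm _)); exact: le_trans.
Qed.

End continuity_euclidean.

Section distance_function.
Context {R : realType} {n : nat}.
Variable F : set 'rV[R]_n.
Hypotheses (F0 : F !=set0) (cF : closed F).
Implicit Types (x y z : 'rV[R]_n).

Let dist x := inf [set enorm (x - y) | y in F].

Let lbd x : lbound [set enorm (x - y) | y in F] 0.
Proof. by move=> _ [y _ <-]; exact: enorm_ge0. Qed.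

Lemma dist_le x y : F y -> dist x <= enorm (x - y).
Proof. by move=> Fy; apply: ge_inf; [exists 0; exact: lbd|exists y]. Qed.

Lemma dist_ge0 x : 0 <= dist x.
Proof.
apply: (lb_le_inf _ (@lbd x)).
by have [y Fy] := F0; exists (enorm (x - y)); exists y.
Qed.

Lemma dist_lip x z : dist x <= dist z + enorm (x - z).
Proof.
rewrite -lerBlDr [leRHS]/dist; apply: lb_le_inf.
  by have [y Fy] := F0; exists (enorm (z - y)); exists y.
move=> _ [y Fy <-]; rewrite lerBlDr (le_trans (dist_le x Fy))//.
have -> : x - y = (z - y) + (x - z) by rewrite [RHS]addrC addrA subrK.
exact: enormD.
Qed.

Lemma continuous_enormB y : continuous (fun x => enorm (x - y)).
Proof.
apply: continuous_enorm => i.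
rewrite (_ : (fun x => (x - y) ord0 i) = (fun x : 'rV[R]_n => x ord0 i - y ord0 i)).
  by apply: continuousB_cst; exact: coord_continuous.
by apply/funext => z; rewrite !mxE.
Qed.

Lemma continuous_dist : continuous dist.
Proof.
apply: (@continuous_modulus _ _ _ (fun x z => enorm (z - x))) => [x|x|x z].
- exact: continuous_enormB.
- by rewrite subrr -[X in enorm X](scale0r 0) enormZ normr0 mul0r.
have := dist_lip x z; have := dist_lip z x.
by rewrite -[x - z]opprB enormN ler_distl => h1 h2; apply/andP; split; lra.
Qed.

(** The infimum is attained since only the points of F in some closed ball around
x compete for it, and these form a compact set. *)
Lemma dist_nearest x : exists2 y, F y & dist x = enorm (x - y).
Proof.
have [y0 Fy0] := F0.
pose K := F `&` [set y | enorm (y - x) <= enorm (x - y0)].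
have K0 : K !=set0 by exists y0; split => //=; rewrite -opprB enormN.
have cK : compact K.
  apply: bounded_closed_compact.
    exists (enorm x + enorm (x - y0)); split; first exact: num_real.
    move=> M ltM y [_ /= yx]; apply: le_trans (ltW ltM).
    rewrite [leLHS]/Num.norm/= mx_normrE; apply/bigmax_leP; split => /=.
      by rewrite addr_ge0// enorm_ge0.
    move=> [i j] _; rewrite ord1/= (le_trans (coord_le_enorm _ _))//.
    rewrite -(subrK x y) (le_trans (enormD _ _))// (addrC (enorm _)).
    by rewrite lerD2l.
  apply: closedI => //.
  apply: (@preimage_closed _ _ (fun y => enorm (y - x)) [set t | t <= enorm (x - y0)]).
    by move=> y _; exact: continuous_enormB.
  exact: closed_le.
have [y] := EVT_min_rV K0 cK (continuous_subspaceT (@continuous_enormB x)).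
rewrite inE => -[Fy Ky] ymin; exists y => //.
apply/eqP; rewrite eq_le dist_le//=; apply: lb_le_inf.
  by exists (enorm (x - y)); exists y.
move=> _ [z Fz <-]; have [zx|zx] := leP (enorm (z - x)) (enorm (x - y0)).
  by rewrite -opprB enormN -[leRHS]enormN opprB; apply: ymin; rewrite inE.
by rewrite -opprB enormN -[leRHS]enormN opprB (le_trans _ (ltW zx)).
Qed.

Lemma dist_gt0 x : ~ F x -> 0 < dist x.
Proof.
move=> Fx; rewrite lt0r dist_ge0 andbT; apply/eqP => dx.
have [y Fy] := dist_nearest x; rewrite dx => xy; apply: Fx.
suff /eqP : x - y = 0 by rewrite subr_eq0 => /eqP ->.
by apply: edot_eq0; rewrite -enorm_sqr -xy expr0n.
Qed.

Let line (i : 'I_n) x t := t *: delta_mx ord0 i + x.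

(* |z|^2 - dist(z)^2 is the supremum over y in F of the affine functions
   2 y.z - |y|^2, hence convex. *)
Let h i x t := edot (line i x t) (line i x t) - dist (line i x t) ^+ 2.

(* A subgradient at t is twice the i-th coordinate of a nearest point. *)
Let h_convex i x : exists m : R -> R, forall s t, h i x t + m t * (s - t) <= h i x s.
Proof.
have Y t := cid2 (dist_nearest (line i x t)).
exists (fun t => 2 * (projT1 (Y t)) ord0 i) => s t.
case: (Y t) => y Fy /= dy.
have : dist (line i x s) ^+ 2 <= edot (line i x s - y) (line i x s - y).
  by rewrite -enorm_sqr ler_sqr ?nnegrE ?dist_ge0 ?enorm_ge0// dist_le.
rewrite /h dy enorm_sqr /line !edotE !edot_delta !mxE !eqxx/=.
rewrite !(edotC _ (delta_mx _ _)) !edot_delta (edotC y x).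
by nra.
Qed.

(** On a line, dist^2 is a quadratic polynomial minus a convex function, so it is
differentiable outside a countable set; off F its square root is then too. *)
Lemma dist_derivable_countable i x :
  countable [set t | ~ F (line i x t) /\ ~ derivable dist (line i x t) (delta_mx ord0 i)].
Proof.
have [m hm] := h_convex i x.
apply: sub_countable (convex_derivable_countable hm); apply: subset_card_le => t /=.
move=> [Ft]; apply: contra_not => dh.
apply/derivable_line.
have d0 := dist_gt0 Ft.
have dsq : derivable (fun t => dist (line i x t) ^+ 2) t 1.
  rewrite (_ : (fun t => _) = (fun t : R => t ^+ 2 + t * (2 * x ord0 i) + edot x x) \- h i x).
    by apply: derivableB => //; have [] := is_derive_quadratic t (2 * x ord0 i) (edot x x).
  apply/funext => s; rewrite /= /h /line !edotE !edot_delta !mxE !eqxx/=.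
  by rewrite !(edotC _ (delta_mx _ _)) !edot_delta; ring.
rewrite (_ : (fun s : R => _) = Num.sqrt \o (fun t => dist (line i x t) ^+ 2)); last first.
  by apply/funext => s /=; rewrite sqrtr_sqr ger0_norm// dist_ge0.
apply: ex_derive; apply: is_derive1_comp; last exact: derivableP.
by apply: is_derive1_sqrt; rewrite exprn_gt0.
Qed.

(** The function z |-> |z - y|^2 - dist(z)^2 is nonnegative and vanishes at x, so
its i-th partial derivative at x, if it exists, is zero. *)
Lemma partial_dist i x y : F y -> dist x = enorm (x - y) ->
  derivable dist x (delta_mx ord0 i) ->
  dist x * partial i dist x = (x - y) ord0 i.
Proof.
move=> Fy dxy /derivableP dd.
pose g t := edot (line i (x - y) t) (line i (x - y) t) - dist (line i x t) ^+ 2.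
have dd2 : is_derive (0:R) 1 (fun t => dist (line i x t) ^+ 2) (2 * (dist x * partial i dist x)).
  have /is_derive_line0 dd0 := dd.
  apply: is_derive_eq.
  by rewrite /line scale0r add0r /partial /GRing.scale/=; ring.
have dg : is_derive (0:R) 1 g (2 * (x - y) ord0 i - 2 * (dist x * partial i dist x)).
  rewrite (_ : g = (fun t : R => t ^+ 2 + t * (2 * (x - y) ord0 i) + edot (x - y) (x - y)) \-
     (fun t => dist (line i x t) ^+ 2)).
    apply: is_deriveB; have := is_derive_quadratic 0 (2 * (x - y) ord0 i) (edot (x - y) (x - y)).
    by rewrite mulr0 add0r.
  apply/funext => s; rewrite /g /line /=; move: (x - y) => z.
  by rewrite !edotE !edot_delta !mxE !eqxx/= !(edotC _ (delta_mx _ _)) !edot_delta; ring.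
have g0 : g 0 = 0.
  by rewrite /g /line !scale0r !add0r dxy enorm_sqr subrr.
have gmin t : g 0 <= g t.
  rewrite g0 /g subr_ge0 -enorm_sqr ler_sqr ?nnegrE ?dist_ge0 ?enorm_ge0//.
  by rewrite /line addrA dist_le.
by have := is_derive_min gmin dg; lra.
Qed.

End distance_function.

(** * Powers and the remainder C_p *)

Section power_functions.
Context {R : realType}.
Variable p : R.
Hypothesis p1 : 1 < p.
Implicit Types s t a b : R.

Let p0 : 0 < p. Proof. exact: lt_trans p1. Qed.

Lemma ppow0 : ppow p (0 : R) = 0. Proof. by rewrite /ppow mulr0. Qed.

Lemma ppowM a b : ppow p (a * b) = ppow p a * ppow p b.
Proof. by rewrite /ppow normrM powRM// mulrACA. Qed.

Lemma ppow_mul s : ppow p s * s = `|s| `^ p.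
Proof.
have [->|s0] := eqVneq s 0; first by rewrite mulr0 normr0 powR0// gt_eqF.
rewrite /ppow -mulrA -expr2 -[s ^+ 2]real_normK ?num_real// -powR_mulrn//.
by rewrite -powRD ?normr_eq0 ?s0 ?implybT// subrK.
Qed.

Lemma ppow_pos a : 0 < a -> ppow p a = a `^ (p - 1).
Proof.
move=> a0; rewrite /ppow gtr0_norm// -[X in _ * X]powRr1 ?ltW//.
by rewrite -powRD ?(gt_eqF a0) ?implybT//; congr (_ `^ _); ring.
Qed.

Lemma ppow_div a b : 0 < b -> ppow p (a / b) = ppow p a * b `^ (1 - p).
Proof.
move=> b0; rewrite ppowM [ppow p b^-1]ppow_pos ?invr_gt0// -(powR_inv1 (ltW b0)) -powRrM.
by congr (_ * _ `^ _); ring.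
Qed.

Lemma norm_ppow s : `|ppow p s| = `|s| `^ (p - 1).
Proof.
have [->|s0] := eqVneq s 0.
  by rewrite ppow0 !normr0 powR0// subr_eq0 gt_eqF.
by rewrite -ppow_pos ?normr_gt0// /ppow normrM normr_id ger0_norm ?powR_ge0.
Qed.

Lemma continuous_powR_norm q : 0 < q -> continuous (fun s : R => `|s| `^ q).
Proof.
move=> q0 s; have qN0 : q != 0 by rewrite gt_eqF.
have [->|s0] := eqVneq s 0.
  apply/cvgrPdist_lt => e e0; rewrite normr0 powR0 ?gt_eqF//.
  apply/nbhs_ballP; exists (e `^ q^-1); first by rewrite /= powR_gt0.
  move=> t; rewrite /ball/= !sub0r !normrN => te.
  rewrite ger0_norm ?powR_ge0// -[ltRHS]powRr1 ?ltW//.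
  rewrite -(mulVf qN0) powRrM.
  by apply: gt0_ltr_powR => //; rewrite nnegrE ?powR_ge0.
apply: (@continuous_comp _ _ _ (fun s : R => `|s|) (fun t => t `^ q)).
  exact: norm_continuous.
apply: differentiable_continuous; apply/derivable1_diffP.
by apply: derivable_powR; rewrite in_itv/= normr_gt0 s0.
Qed.

Lemma continuous_ppow : continuous (ppow p).
Proof.
move=> s; have [->|s0] := eqVneq s 0.
  have q0 : 0 < p - 1 by rewrite subr_gt0.
  have /cvgrPdist_lt h := continuous_powR_norm q0 (x := 0).
  apply/cvgrPdist_lt => e e0; have := h e e0; apply: filterS => t.
  rewrite ppow0 normr0 powR0 ?subr_eq0 ?gt_eqF// !sub0r !normrN norm_ppow.
  by rewrite ger0_norm// powR_ge0.
apply: (@continuousM _ _ (fun s : R => `|s| `^ (p - 2)) id); last exact: cvg_id.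
apply: (@continuous_comp _ _ _ (fun s : R => `|s|) (fun t => t `^ (p - 2))).
  exact: norm_continuous.
apply: differentiable_continuous; apply/derivable1_diffP.
by apply: derivable_powR; rewrite in_itv/= normr_gt0 s0.
Qed.

(** At 0 the difference quotient of |s|^p is ppow p, which is continuous there and
vanishes because 1 < p. *)
Lemma is_derive_powR_norm s : is_derive s 1 (fun s : R => `|s| `^ p) (p * ppow p s).
Proof.
have [->|s0] := eqVneq s 0.
  rewrite ppow0 mulr0.
  have E : h^-1 *: (((fun s : R => `|s| `^ p) \o shift (0:R)) (h *: (1:R)) - `|0:R| `^ p)
     @[h --> (0:R)^'] --> (0:R).
    have c := @continuous_ppow 0; rewrite /continuous_at ppow0 in c.
    have {}c : ppow p h @[h --> (0:R)^'] --> (0:R) by exact: cvg_within_filter c.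
    refine (cvg_trans _ c); apply: near_eq_cvg; near=> h; apply/esym.
    have h0 : h != 0 by near: h; exact: nbhs_dnbhs_neq.
    rewrite /= [h%:A]mulr1 addr0 normr0 powR0 ?gt_eqF// subr0 -ppow_mul.
    by rewrite /GRing.scale/= mulrCA mulVf// mulr1.
  split; first by apply/cvg_ex; exists 0.
  by rewrite /derive; apply: cvg_lim.
have [sn|sp|s00] := ltgtP s 0; last by rewrite s00 eqxx in s0.
  apply: (@near_eq_is_derive _ _ _ (fun s => (- s) `^ p)).
    near=> t; rewrite ltr0_norm//.
    by near: t; exact: lt_nbhsl.
  have -> : p * ppow p s = p * (- s) `^ (p - 1) * -1.
    rewrite -[in ppow p s](opprK s) -[- - s]mulN1r ppowM [ppow p (- s)]ppow_pos ?oppr_gt0//.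
    by rewrite /ppow normrN1 powR1; ring.
  apply: (@is_derive1_comp _ (fun t => t `^ p) (fun s => - s)).
  by apply: is_derive1_powR; rewrite oppr_gt0.
apply: (@near_eq_is_derive _ _ _ (fun s => s `^ p)).
  near=> t; rewrite gtr0_norm//.
  by near: t; exact: lt_nbhsr.
by rewrite ppow_pos//; exact: is_derive1_powR.
Unshelve. all: by end_near. Qed.

(** With |g| = 1 the vector c g has norm |c|, and the part of the last term of
C_p that is quadratic in c g adds p |c|^p. *)
Lemma Cp_sub n (a g : 'rV[R]_n) (c : R) : edot g g = 1 ->
  Cp p a (a - c *: g) = enorm a `^ p + (p - 1) * `|c| `^ p - p * ppow p c * edot g a.
Proof.
move=> g1.
have ng : enorm g = 1 by rewrite /enorm g1 sqrtr1.
rewrite /Cp opprB addrCA subrr addr0 enormZ ng mulr1 !edotE g1 mulr1.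
rewrite -ppow_mul /ppow; ring.
Qed.

End power_functions.

Section scalars_as_vectors.
Context {R : realType}.
Implicit Types a b : R.

Lemma scalar_coord a i : (a%:M : 'rV[R]_1) ord0 i = a.
Proof. by rewrite (ord1 i) mxE eqxx. Qed.

Lemma edot_scalar a b : edot (a%:M : 'rV[R]_1) b%:M = a * b.
Proof. by rewrite /edot big_ord1 !scalar_coord. Qed.

Lemma enorm_scalar a : enorm (a%:M : 'rV[R]_1) = `|a|.
Proof. by rewrite /enorm edot_scalar -expr2 sqrtr_sqr. Qed.

Lemma Cp_sub_scalar p (a c : R) : 1 < p ->
  Cp p (a%:M : 'rV[R]_1) (a - c)%:M =
  `|a| `^ p + (p - 1) * `|c| `^ p - p * ppow p c * a.
Proof.
move=> p1; have -> : (a - c)%:M = a%:M - c *: 1%:M :> 'rV[R]_1.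
  by rewrite scale_scalar_mx mulr1 raddfB.
by rewrite Cp_sub// ?edot_scalar ?mulr1// enorm_scalar mul1r.
Qed.

End scalars_as_vectors.

(** * The Riccati equation of a Bessel pair *)

Section bessel_flux.
Context {R : realType}.
Variables (p : R) (b : \bar R) (V W phi : R -> R).
Hypotheses (p1 : 1 < p) (sol : positive_solution p b V W phi).

(** Write the function as the flux V |phi'|^(p-2) phi' times phi^(1-p): the
equation gives the derivative of the flux, although phi' itself need not be
differentiable. *)
Lemma is_derive_riccati t : itv0 b t ->
  is_derive t 1 (fun s => V s * ppow p (derive1 phi s / phi s))
    (- W t - (p - 1) * V t * `|derive1 phi t / phi t| `^ p).
Proof.
move=> bt; have [phi0 C1phi ode _] := sol.
have [dphi _] := C1phi t bt; have pt := phi0 t bt.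
have [/derivableP dflux eflux] := ode t bt.
rewrite derive1E in eflux.
set flux := (fun s : R => V s * ppow p (derive1 phi s)) in dflux eflux.
have cphi : {for t, continuous phi}.
  by apply: differentiable_continuous; apply/derivable1_diffP.
apply: (@near_eq_is_derive _ _ _ (flux * (fun s => phi s `^ (1 - p)))).
  have : \forall s \near t, 0 < phi s by exact: (@cvgr_gt _ _ _ _ phi (phi t) cphi _ pt).
  by apply: filterS => s ps; rewrite ppow_div// mulrA.
have dpow : is_derive t 1 (fun s => phi s `^ (1 - p))
   ((1 - p) * phi t `^ (1 - p - 1) * derive1 phi t).
  rewrite derive1E; apply: (@is_derive1_comp _ (fun s => s `^ (1 - p)) phi).
    exact: is_derive1_powR.
  exact: derivableP.
apply: is_derive_eq.
have -> : 'D_1 flux t = - (W t * phi t `^ (p - 1)).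
  by rewrite -ppow_pos//; apply/eqP; rewrite -addr_eq0 eflux.
rewrite -ppow_mul ?ppow_div// -[_ *: _]/(_ * _) -[X in _ + X]/(_ * _) /flux.
have -> : phi t `^ (1 - p - 1) = phi t `^ (1 - p) / phi t.
  by rewrite powRB ?(gt_eqF pt) ?implybT// powRr1// ltW.
have E : phi t `^ (1 - p) * phi t `^ (p - 1) = 1.
  rewrite -powRD ?(gt_eqF pt) ?implybT//.
  by rewrite (_ : _ + _ = 0) ?powRr0//; ring.
rewrite [X in _ + X](_ : _ = - W t * (phi t `^ (1 - p) * phi t `^ (p - 1))); last by ring.
rewrite E mulr1; ring.
Qed.

End bessel_flux.

(** * The distance to the boundary of an open set *)

Section distance_gradient.
Context {R : realType} {n : nat}.
Variable A : set 'rV[R]_n.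
Hypotheses (oA : open A) (bA : boundary A !=set0).

Lemma closed_boundary : closed (boundary A).
Proof.
rewrite /boundary setDE; apply: closedI; first exact: closed_closure.
exact/open_closedC/open_interior.
Qed.

Lemma open_notin_boundary x : A x -> ~ boundary A x.
Proof. by move=> Ax [_]; apply; apply: open_nbhs_nbhs. Qed.

Lemma continuous_dist_boundary : continuous (dist_boundary A).
Proof. exact: continuous_dist bA. Qed.

Lemma dist_boundary_gt0 x : A x -> 0 < dist_boundary A x.
Proof.
by move=> Ax; apply: dist_gt0 => //; [exact: closed_boundary|exact: open_notin_boundary].
Qed.

(** The partial derivatives are those of the distance to a nearest boundary point
y, whose gradient (x - y) / |x - y| is a unit vector. *)
Lemma edot_grad_dist x : A x ->
  (forall i, derivable (dist_boundary A) x (delta_mx ord0 i)) ->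
  edot (grad (dist_boundary A) x) (grad (dist_boundary A) x) = 1.
Proof.
move=> Ax dx; have d0 := dist_boundary_gt0 Ax.
have [y Fy dxy] := dist_nearest bA closed_boundary x.
have E : dist_boundary A x *: grad (dist_boundary A) x = x - y.
  by apply/rowP => i; rewrite mxE [X in _ * X]mxE (partial_dist bA Fy).
have /eqP : dist_boundary A x ^+ 2 * edot (grad (dist_boundary A) x) (grad (dist_boundary A) x)
   = dist_boundary A x ^+ 2.
  by rewrite expr2 -mulrA -edotZr -edotZl E -enorm_sqr -expr2 -dxy.
rewrite -subr_eq0 -{2}[_ ^+ 2]mulr1 -mulrBr mulf_eq0 sqrf_eq0 (gt_eqF d0)/= subr_eq0.
by move/eqP.
Qed.

(** For each direction the exceptional set is measurable and meets each line in
that direction in a countable set. *)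
Lemma derivable_dist_boundary_ae :
  {ae lebesgue_rV n, forall x, A x ->
    forall i, derivable (dist_boundary A) x (delta_mx ord0 i)}.
Proof.
have : \forall x \ae lebesgue_rV n, forall i : 'I_n,
    A x -> derivable (dist_boundary A) x (delta_mx ord0 i).
  apply: filter_forall => i.
  exists (A `\` [set x | derivable (dist_boundary A) x (delta_mx ord0 i)]); split.
  - apply: measurableD; first exact: open_measurable_rV.
    apply: measurable_derivable; exact: continuous_dist_boundary.
  - apply: (@lebesgue_rV_countable_lines _ _ i).
      apply: measurableD; first exact: open_measurable_rV.
      apply: measurable_derivable; exact: continuous_dist_boundary.
    move=> x; apply: sub_countable (dist_derivable_countable bA closed_boundary i x).
    apply: subset_card_le => t /= [At dt]; split => //.
    exact: open_notin_boundary.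
  - by move=> x /= /not_implyP.
by apply: filterS => x h Ax i; exact: h.
Qed.

End distance_gradient.

(** * Integration of compactly supported functions *)

Section compact_support.
Context {R : realType}.

(** The open sets A and ~` K cover the space, and f vanishes on the second one. *)
Lemma continuous_extend0 (T : topologicalType) (A K : set T) (f : T -> R) :
  closed K -> K `<=` A -> (forall x, A x -> {for x, continuous f}) ->
  (forall x, ~ K x -> f x = 0) -> continuous f.
Proof.
move=> cK KA cf f0 x; have [Ax|nAx] := pselect (A x); first exact: cf.
have nKx : ~ K x by move=> /KA.
rewrite /continuous_at (f0 _ nKx).
apply: (@cvg_trans _ (cst 0 @ nbhs x)); last exact: cvg_cst.
apply: near_eq_cvg.
have : \forall z \near x, (~` K) z.
  by apply: open_nbhs_nbhs; split => //; exact: closed_openC.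
by apply: filterS => z nKz; rewrite (f0 _ nKz).
Qed.

(** The bound H is itself bounded on K, a set of finite measure. *)
Lemma compact_support_integrable n (A K : set 'rV[R]_n) (f H : 'rV[R]_n -> R) :
  open A -> compact K -> K `<=` A ->
  (forall x, A x -> {for x, continuous H}) -> (forall x, ~ K x -> H x = 0) ->
  measurable_fun A f ->
  {ae lebesgue_rV n, forall x, A x -> `|f x| <= H x} ->
  (lebesgue_rV n).-integrable A (EFin \o f).
Proof.
move=> oA cK KA cH H0 mf fH.
have clK : closed K by apply: compact_closed => //; exact: norm_hausdorff.
have mA := open_measurable_rV oA; have mK := closed_measurable_rV clK.
have [M HM] : exists M : R, forall x, K x -> H x <= M.
  have cHK : compact (H @` K).
    apply: continuous_compact => //; apply: continuous_in_subspaceT => x.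
    by rewrite inE => Kx; apply: cH; exact: KA.
  have [M [_ MH]] := compact_bounded cHK.
  exists (M + 1) => x Kx; apply: le_trans (ler_norm _) _.
  by apply: (MH (M + 1)); [rewrite ltrDl|exists x].
apply/integrableP; split; first exact/measurable_EFinP.
apply: (@le_lt_trans _ _ (\int[lebesgue_rV n]_(x in A) (`|M| * \1_K x)%:E)%E).
  apply: ae_ge0_le_integral => //.
  - by apply: measurableT_comp => //; exact/measurable_EFinP.
  - apply/measurable_EFinP; apply: measurable_funM => //; exact: measurable_indic.
  apply: filterS fH => x fH Ax; rewrite lee_fin.
  apply: le_trans (fH Ax) _; rewrite indicE.
  have [/set_mem Kx|] := boolP (x \in K).
    by rewrite mulr1 (le_trans (HM _ Kx))// ler_norm.
  by move=> /negP; rewrite inE => nK; rewrite (H0 _ nK) mulr0.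
under eq_integral do rewrite EFinM.
rewrite ge0_integralZl//; last exact/measurable_EFinP.
rewrite integral_indic// lte_mul_pinfty//.
by rewrite setIidl//; exact: lebesgue_rV_compact_lty.
Qed.

End compact_support.

(** The function f3 is integrable because it equals f1 - f2 - f4 almost everywhere. *)
Lemma integral_balance d (T : measurableType d) (R : realType)
    (mu : {measure set T -> \bar R}) (D : set T) (f1 f2 f3 f4 : T -> R) :
  measurable D -> mu.-integrable D (EFin \o f1) -> mu.-integrable D (EFin \o f2) ->
  mu.-integrable D (EFin \o f4) -> measurable_fun D f3 ->
  {ae mu, forall x, D x -> f1 x - f2 x = f3 x + f4 x} ->
  (\int[mu]_(x in D) (f1 x)%:E - \int[mu]_(x in D) (f2 x)%:E =
   \int[mu]_(x in D) (f3 x)%:E - (- \int[mu]_(x in D) (f4 x)%:E))%E.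
Proof.
move=> mD i1 i2 i4 m3 E.
have i12 := integrableB mD i1 i2.
have i124 := integrableB mD i12 i4.
have -> : (\int[mu]_(x in D) (f3 x)%:E =
   \int[mu]_(x in D) (((EFin \o f1) \- (EFin \o f2)) \- (EFin \o f4)) x)%E.
  apply: ae_eq_integral => //; first exact/measurable_EFinP.
    by case/integrableP : i124.
  apply: filterS E => x h Dx; rewrite /= -!EFinB; congr EFin.
  by rewrite h// addrK.
rewrite integralB// integralB// oppeK subeK//.
exact: integrable_fin_num.
Qed.

(** * Continuity and measurability of composite functions *)

Section real_valued_continuity.
Context {R : realType} {T : topologicalType}.
Implicit Types (f g : T -> R) (x : T).

Lemma continuous_at_cst (c : R) x : {for x, continuous (fun _ : T => c)}.
Proof. exact: cvg_cst. Qed.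

Lemma continuous_atM f g x : {for x, continuous f} -> {for x, continuous g} ->
  {for x, continuous (fun z => f z * g z)}.
Proof. by move=> cf cg; exact: continuousM. Qed.

Lemma continuous_atD f g x : {for x, continuous f} -> {for x, continuous g} ->
  {for x, continuous (fun z => f z + g z)}.
Proof. by move=> cf cg; exact: continuousD. Qed.

Lemma continuous_at_norm f x : {for x, continuous f} ->
  {for x, continuous (fun z => `|f z|)}.
Proof. by move=> cf; exact: cvg_norm. Qed.

Lemma continuous_atV f x : f x != 0 -> {for x, continuous f} ->
  {for x, continuous (fun z => (f z)^-1)}.
Proof. by move=> fx cf; exact: continuousV. Qed.

Lemma continuous_at_comp (h : R -> R) f x : {for f x, continuous h} ->
  {for x, continuous f} -> {for x, continuous (fun z => h (f z))}.
Proof. by move=> ch cf; exact: continuous_comp. Qed.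

End real_valued_continuity.

Section measurable_vectors.
Context d {T : measurableType d} {R : realType} {n : nat}.
Variable D : set T.
Implicit Types f g : T -> 'rV[R]_n.

Lemma measurable_edot f g :
  (forall i, measurable_fun D (fun x => f x ord0 i)) ->
  (forall i, measurable_fun D (fun x => g x ord0 i)) ->
  measurable_fun D (fun x => edot (f x) (g x)).
Proof.
by move=> mf mg; apply: measurable_sum => i; apply: measurable_funM.
Qed.

Lemma measurable_enorm f :
  (forall i, measurable_fun D (fun x => f x ord0 i)) ->
  measurable_fun D (fun x => enorm (f x)).
Proof.
move=> mf; have msqrt := continuous_measurable_fun (@sqrt_continuous R).
by apply: (measurableT_comp msqrt); exact: measurable_edot.
Qed.

Lemma measurable_Cp p f g :
  (forall i, measurable_fun D (fun x => f x ord0 i)) ->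
  (forall i, measurable_fun D (fun x => g x ord0 i)) ->
  measurable_fun D (fun x => Cp p (f x) (g x)).
Proof.
move=> mf mg.
have mfg i : measurable_fun D (fun x => (f x - g x) ord0 i).
  rewrite (_ : (fun x => _) = (fun x => f x ord0 i - g x ord0 i)).
    exact: measurable_funB.
  by apply/funext => x; rewrite !mxE.
have mpow q : measurable_fun D (fun x => enorm (f x - g x) `^ q).
  apply: (measurableT_comp (measurable_powR q)); exact: measurable_enorm.
apply: measurable_funB; first apply: measurable_funB => //.
  apply: (measurableT_comp (measurable_powR p)); exact: measurable_enorm.
apply: measurable_funM; first exact: measurable_funM.
exact: measurable_edot.
Qed.

End measurable_vectors.

(** * The identities *)

Section hardy_identity.
Context {R : realType} {N : nat}.
Variables (p : R) (Om : set 'rV[R]_N) (b : \bar R) (V W phi : R -> R).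
Variable u : 'rV[R]_N -> R.
Hypotheses (p1 : 1 < p) (oOm : open Om) (bOm : boundary Om !=set0).
Let d := dist_boundary Om.
Hypothesis db : forall x, Om x -> itv0 b (d x).
Hypotheses (bp : bessel_pair p b V W) (sol : positive_solution p b V W phi).
Hypothesis tu : test_function Om u.

Let K := closure [set x | u x != 0].
Let q t := derive1 phi t / phi t.
Let G t := V t * ppow p (q t).
Let v x := u x / phi (d x).
Let psi x := G (d x) * `|u x| `^ p.

Let p0 : 0 < p. Proof. exact: lt_trans p1. Qed.
Let cK : compact K. Proof. by case: tu. Qed.
Let KOm : K `<=` Om. Proof. by case: tu. Qed.
Let clK : closed K. Proof. exact: closed_closure. Qed.
Let cd : continuous d. Proof. exact: continuous_dist_boundary. Qed.
Let cu : continuous u. Proof. by case: tu => /(_ [::])[]. Qed.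
Let du x i : derivable u x (delta_mx ord0 i).
Proof. by case: tu => /(_ [::])[_ +] _ _; exact. Qed.
Let cpu i : continuous (partial i u).
Proof. by case: tu => /(_ [:: i])[]. Qed.

Let u0 x : ~ K x -> u x = 0.
Proof. by move=> nKx; apply: contra_notP nKx => /eqP ux; apply: subset_closure. Qed.

Let gu0 x : ~ K x -> grad u x = 0.
Proof.
move=> nKx; apply/rowP => i; rewrite !mxE /partial.
rewrite (@near_eq_derive _ _ _ _ (cst 0)) ?derive_cst//.
have : \forall z \near x, (~` K) z.
  by apply: open_nbhs_nbhs; split => //; exact: closed_openC.
by apply: filterS => z; exact: u0.
Qed.

Let phi_gt0 x : Om x -> 0 < phi (d x).
Proof. by move=> Ox; case: sol => + _ _ _; apply; exact: db. Qed.

Let C1_continuous f t : C1_on (itv0 b) f -> itv0 b t -> {for t, continuous f}.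
Proof.
move=> C1 bt; have [df _] := C1 t bt.
by apply: differentiable_continuous; apply/derivable1_diffP.
Qed.

Let cVd x : Om x -> {for x, continuous (V \o d)}.
Proof.
move=> Ox; apply: continuous_at_comp; last exact: cd.
by apply: C1_continuous; [case: bp|exact: db].
Qed.

Let cWd x : Om x -> {for x, continuous (W \o d)}.
Proof.
move=> Ox; apply: continuous_at_comp; last exact: cd.
by apply: C1_continuous; [case: bp|exact: db].
Qed.

Let cphid x : Om x -> {for x, continuous (fun x => phi (d x))}.
Proof.
move=> Ox; apply: continuous_at_comp; last exact: cd.
by apply: C1_continuous; [case: sol|exact: db].
Qed.

Let cqd x : Om x -> {for x, continuous (fun x => q (d x))}.
Proof.
move=> Ox; apply: continuous_atM.
  apply: (@continuous_at_comp _ _ (derive1 phi)); last exact: cd.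
  by case: sol => _ /(_ _ (db Ox))[].
by apply: continuous_atV; [rewrite gt_eqF// phi_gt0|exact: cphid].
Qed.

Let cGd x : Om x -> {for x, continuous (fun x => G (d x))}.
Proof.
move=> Ox; apply: continuous_atM; first exact: cVd.
apply: (@continuous_at_comp _ _ (ppow p)); last exact: cqd.
exact: continuous_ppow.
Qed.

Let cup : continuous (fun x => `|u x| `^ p).
Proof.
move=> x; apply: (@continuous_at_comp _ _ (fun s => `|s| `^ p)); last exact: cu.
exact: continuous_powR_norm.
Qed.

Let cv : continuous v.
Proof.
apply: (continuous_extend0 clK KOm) => [x Ox|x nK]; last by rewrite /v u0// mul0r.
apply: continuous_atM; first exact: cu.
by apply: continuous_atV; [rewrite gt_eqF// phi_gt0|exact: cphid].
Qed.

Let cpsi : continuous psi.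
Proof.
apply: (continuous_extend0 clK KOm) => [x Ox|x nK].
  by apply: continuous_atM; [exact: cGd|exact: cup].
by rewrite /psi u0// normr0 powR0 ?mulr0// gt_eqF.
Qed.

Let mgrad f i : continuous f -> measurable_fun Om (fun x => grad f x ord0 i).
Proof.
move=> cf; rewrite (_ : (fun x => _) = partial i f); last first.
  by apply/funext => x; rewrite mxE.
apply: (measurable_funS (E := setT)) => //; exact: measurable_derive.
Qed.

Let mV : measurable_fun Om (V \o d).
Proof. exact: continuous_measurable_rV. Qed.

Let cgradu : continuous (fun x => enorm (grad u x)).
Proof.
apply: continuous_enorm => i.
rewrite (_ : (fun x => _) = partial i u) //.
by apply/funext => x; rewrite mxE.
Qed.

Let cf1 x : Om x -> {for x, continuous (fun x => V (d x) * enorm (grad u x) `^ p)}.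
Proof.
move=> Ox; apply: continuous_atM; first exact: cVd.
rewrite (_ : (fun z => _) = (fun z => `|enorm (grad u z)| `^ p)); last first.
  by apply/funext => z; rewrite ger0_norm ?enorm_ge0.
apply: (@continuous_at_comp _ _ (fun s => `|s| `^ p)); last exact: cgradu.
exact: continuous_powR_norm.
Qed.

Section regular_point.
Variable x : 'rV[R]_N.
Hypothesis Ox : Om x.
Hypothesis dx : forall i, derivable d x (delta_mx ord0 i).

Let is_derive_d i : is_derive x (delta_mx ord0 i) d (partial i d x).
Proof. exact: derivableP. Qed.

Let is_derive_u i : is_derive x (delta_mx ord0 i) u (partial i u x).
Proof. exact: derivableP. Qed.

Let is_derive_phi : is_derive (d x) 1 phi (derive1 phi (d x)).
Proof.
rewrite derive1E; apply: derivableP.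
by case: sol => _ /(_ _ (db Ox))[].
Qed.

Let grad_v : phi (d x) *: grad v x = grad u x - (u x * q (d x)) *: grad d x.
Proof.
have phi0 := phi_gt0 Ox; have phiN0 : phi (d x) != 0 by rewrite gt_eqF.
apply/rowP => i; rewrite !mxE.
have dV : is_derive (d x) 1 (fun s => (phi s)^-1)
    (- (phi (d x)) ^- 2 *: derive1 phi (d x)).
  exact: is_deriveV.
have dVd := is_derive_comp_real dV (is_derive_d i).
have dv : is_derive x (delta_mx ord0 i) v
   (u x *: (- (phi (d x)) ^- 2 *: derive1 phi (d x) * partial i d x) +
     (phi (d x))^-1 *: partial i u x).
  exact: is_deriveM.
have -> : partial i v x = u x *: (- (phi (d x)) ^- 2 *: derive1 phi (d x) * partial i d x) +
     (phi (d x))^-1 *: partial i u x by exact: derive_val.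
rewrite /GRing.scale/= /q; field.
exact: phiN0.
Qed.

Let grad_psi : grad psi x =
  ((- W (d x) - (p - 1) * V (d x) * `|q (d x)| `^ p) * `|u x| `^ p) *: grad d x +
  (G (d x) * (p * ppow p (u x))) *: grad u x.
Proof.
apply/rowP => i; rewrite !mxE.
have dG := is_derive_comp_real (is_derive_riccati p1 sol (db Ox)) (is_derive_d i).
have dup := is_derive_comp_real (is_derive_powR_norm p1 (u x)) (is_derive_u i).
have dpsi : is_derive x (delta_mx ord0 i) psi
   (G (d x) *: (p * ppow p (u x) * partial i u x) + `|u x| `^ p *:
    ((- W (d x) - (p - 1) * V (d x) * `|q (d x)| `^ p) * partial i d x)).
  exact: is_deriveM.
have -> : partial i psi x = G (d x) *: (p * ppow p (u x) * partial i u x) + `|u x| `^ p *: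
    ((- W (d x) - (p - 1) * V (d x) * `|q (d x)| `^ p) * partial i d x).
  exact: derive_val.
by rewrite /GRing.scale/=; ring.
Qed.

Let g1 : edot (grad d x) (grad d x) = 1.
Proof. exact: edot_grad_dist. Qed.

Lemma edot_grad_psi : edot (grad d x) (grad psi x) =
  (- W (d x) - (p - 1) * V (d x) * `|q (d x)| `^ p) * `|u x| `^ p +
  G (d x) * (p * ppow p (u x)) * edot (grad d x) (grad u x).
Proof. by rewrite grad_psi !edotE g1 mulr1. Qed.

(** Cauchy-Schwarz, as grad d is a unit vector. *)
Lemma abs_edot_grad : `|edot (grad d x) (grad u x)| <= enorm (grad u x).
Proof.
have ng : enorm (grad d x) = 1 by rewrite /enorm g1 sqrtr1.
rewrite ler_norml -[X in - X <= _]mul1r -[X in _ <= _ <= X]mul1r -ng edot_le andbT.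
by rewrite lerNl -edotNl -(enormN (grad d x)) edot_le.
Qed.

Lemma hardy_vector : V (d x) * enorm (grad u x) `^ p - W (d x) * `|u x| `^ p =
  V (d x) * Cp p (grad u x) (phi (d x) *: grad v x) + edot (grad d x) (grad psi x).
Proof.
rewrite edot_grad_psi grad_v Cp_sub// ppowM normrM powRM// /G.
ring.
Qed.

Lemma hardy_scalar :
  V (d x) * `|edot (grad d x) (grad u x)| `^ p - W (d x) * `|u x| `^ p =
  V (d x) * Cp p ((edot (grad d x) (grad u x))%:M : 'rV[R]_1)
                 ((phi (d x) * edot (grad d x) (grad v x))%:M)
  + edot (grad d x) (grad psi x).
Proof.
rewrite edot_grad_psi -edotZr grad_v edotDr edotNr edotZr g1 mulr1.
rewrite Cp_sub_scalar// ppowM normrM powRM// /G.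
ring.
Qed.

End regular_point.

Let ae_regular (P : 'rV[R]_N -> Prop) :
  (forall x, Om x -> (forall i, derivable d x (delta_mx ord0 i)) -> P x) ->
  {ae lebesgue_rV N, forall x, Om x -> P x}.
Proof.
move=> h; apply: filterS (derivable_dist_boundary_ae oOm bOm) => x hx Ox.
exact: h (hx Ox).
Qed.

Let medot f g : continuous f -> continuous g ->
  measurable_fun Om (fun x => edot (grad f x) (grad g x)).
Proof. by move=> cf cg; apply: measurable_edot => i; exact: mgrad. Qed.

Let f1_support x : ~ K x -> V (d x) * enorm (grad u x) `^ p = 0.
Proof.
move=> nK; rewrite gu0// -(scale0r 0) enormZ normr0 mul0r powR0 ?mulr0//.
by rewrite gt_eqF.
Qed.

Let V_gt0 x : Om x -> 0 < V (d x).
Proof. by move=> Ox; case: bp => + _ _ _ _; apply; exact: db. Qed.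

Let W_gt0 x : Om x -> 0 < W (d x).
Proof. by move=> Ox; case: bp => _ + _ _ _; apply; exact: db. Qed.

Let int_f1 : (lebesgue_rV N).-integrable Om
  (EFin \o (fun x => V (d x) * enorm (grad u x) `^ p)).
Proof.
apply: (compact_support_integrable oOm cK KOm cf1) => //.
  exact: continuous_measurable_rV.
by apply: aeW => x Ox; rewrite ger0_norm// mulr_ge0 ?powR_ge0// ltW// V_gt0.
Qed.

Let int_f1' : (lebesgue_rV N).-integrable Om
  (EFin \o (fun x => V (d x) * `|edot (grad d x) (grad u x)| `^ p)).
Proof.
apply: (compact_support_integrable oOm cK KOm cf1) => //.
  apply: measurable_funM => //.
  apply: (measurableT_comp (measurable_powR p)).
  by apply: measurableT_comp => //; exact: medot.
apply: ae_regular => x Ox dx.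
have V0 := ltW (V_gt0 Ox).
rewrite ger0_norm ?mulr_ge0 ?powR_ge0// ler_wpM2l//.
apply: ge0_ler_powR; rewrite ?nnegrE ?enorm_ge0//; first exact: ltW.
exact: abs_edot_grad.
Qed.

Let int_f2 : (lebesgue_rV N).-integrable Om
  (EFin \o (fun x => W (d x) * `|u x| `^ p)).
Proof.
have cf2 x : Om x -> {for x, continuous (fun x => W (d x) * `|u x| `^ p)}.
  by move=> Ox; apply: continuous_atM; [exact: cWd|exact: cup].
apply: (compact_support_integrable oOm cK KOm cf2) => //.
- by move=> x nK; rewrite u0// normr0 powR0 ?mulr0// gt_eqF.
- exact: continuous_measurable_rV.
by apply: aeW => x Ox; rewrite ger0_norm// mulr_ge0 ?powR_ge0// ltW// W_gt0.
Qed.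

Let int_f4 : (lebesgue_rV N).-integrable Om
  (EFin \o (fun x => edot (grad d x) (grad psi x))).
Proof.
(* A bound for |grad d . grad psi| at regular points: replace the two terms of
   [edot_grad_psi] by their absolute values and grad d . grad u by |grad u|. *)
pose H x := (W (d x) + (p - 1) * (V (d x) * `|q (d x)| `^ p)) * `|u x| `^ p +
  p * `|G (d x) * ppow p (u x)| * enorm (grad u x).
have cH x : Om x -> {for x, continuous H}.
  move=> Ox; apply: continuous_atD; apply: continuous_atM.
  - apply: continuous_atD; first exact: cWd.
    apply: continuous_atM; first exact: continuous_at_cst.
    apply: continuous_atM; first exact: cVd.
    apply: (@continuous_at_comp _ _ (fun s => `|s| `^ p)); last exact: cqd.
    exact: continuous_powR_norm.
  - exact: cup.
  - apply: continuous_atM; first exact: continuous_at_cst.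
    apply: continuous_at_norm; apply: continuous_atM; first exact: cGd.
    apply: (@continuous_at_comp _ _ (ppow p)); last exact: cu.
    exact: continuous_ppow.
  - exact: cgradu.
apply: (compact_support_integrable oOm cK KOm cH) => //.
- move=> x nK; rewrite /H u0// ppow0 normr0 powR0 ?gt_eqF//.
  by rewrite !mulr0 normr0 !(mulr0, mul0r) addr0.
- exact: medot.
apply: ae_regular => x Ox dx; rewrite edot_grad_psi//.
rewrite (le_trans (ler_normD _ _))// lerD//.
  rewrite normrM [X in _ * X <= _]ger0_norm ?powR_ge0// ler_wpM2r ?powR_ge0//.
  rewrite -opprD normrN ger0_norm ?mulrA// addr_ge0 ?(ltW (W_gt0 Ox))//.
  by rewrite !mulr_ge0 ?powR_ge0 ?(ltW (V_gt0 Ox))// subr_ge0 ltW.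
rewrite mulrCA normrM ler_pM//; last exact: abs_edot_grad.
by rewrite normrM (gtr0_norm p0).
Qed.

Lemma hardy_identities :
  (\int[lebesgue_rV N]_(x in Om) (V (d x) * enorm (grad u x) `^ p)%:E
     - \int[lebesgue_rV N]_(x in Om) (W (d x) * `|u x| `^ p)%:E
   = \int[lebesgue_rV N]_(x in Om)
       (V (d x) * Cp p (grad u x) (phi (d x) *: grad v x))%:E
     - laplacian_dist Om psi)%E
  /\
  (\int[lebesgue_rV N]_(x in Om) (V (d x) * `|edot (grad d x) (grad u x)| `^ p)%:E
     - \int[lebesgue_rV N]_(x in Om) (W (d x) * `|u x| `^ p)%:E
   = \int[lebesgue_rV N]_(x in Om)
       (V (d x) * Cp p ((edot (grad d x) (grad u x))%:M : 'rV[R]_1)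
                       ((phi (d x) * edot (grad d x) (grad v x))%:M))%:E
     - laplacian_dist Om psi)%E.
Proof.
have mphi : measurable_fun Om (fun x => phi (d x)) by exact: continuous_measurable_rV.
have mOm := open_measurable_rV oOm.
split; apply: integral_balance => //.
- apply: measurable_funM => //; apply: measurable_Cp => i; first exact: mgrad.
  rewrite (_ : (fun x => _) = (fun x => phi (d x) * grad v x ord0 i)).
    by apply: measurable_funM => //; exact: mgrad.
  by apply/funext => x; rewrite mxE.
- by apply: ae_regular => x Ox dx; exact: hardy_vector.
- apply: measurable_funM => //; apply: measurable_Cp => i.
    rewrite (_ : (fun x => _) = (fun x => edot (grad d x) (grad u x))); first exact: medot.
    by apply/funext => x; exact: scalar_coord.
  rewrite (_ : (fun x => _) = (fun x => phi (d x) * edot (grad d x) (grad v x))).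
    by apply: measurable_funM => //; exact: medot.
  by apply/funext => x; exact: scalar_coord.
- by apply: ae_regular => x Ox dx; exact: hardy_scalar.
Qed.

End hardy_identity.

(** If the boundary is empty, the distance to it is an infimum over the empty set,
which is 0 by convention, and so is the inradius. *)
Lemma boundary_nonempty (R : realType) N (A : set 'rV[R]_N) :
  (0 < inradius A)%E -> boundary A !=set0.
Proof.
move=> r0; apply/set0P; apply: contraTneq r0 => b0.
rewrite -leNgt; apply: ub_ereal_sup => _ [x _ <-].
by rewrite lee_fin /dist_boundary b0 image_set0 inf0.
Qed.

Lemma dist_boundary_itv (R : realType) N (A : set 'rV[R]_N) (b : \bar R) :
  open A -> (0 < inradius A)%E ->
  ((inradius A < +oo)%E -> (inradius A < b)%E) -> (inradius A = +oo%E -> b = +oo%E) ->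
  forall x, A x -> itv0 b (dist_boundary A x).
Proof.
move=> oA r0 rb rbo x Ax; split.
  by apply: dist_boundary_gt0 => //; exact: boundary_nonempty.
have dr : ((dist_boundary A x)%:E <= inradius A)%E.
  by apply: ereal_sup_ubound; exists x.
have [roo|] := ltP (inradius A) +oo%E; first exact: le_lt_trans dr (rb roo).
by rewrite leye_eq => /eqP/rbo ->; exact: ltry.
Qed.

Theorem theorem3p5 (R : realType) (N : nat) (p : R) (Om : set 'rV[R]_N)
    (rho b : \bar R) (V W phi : R -> R) (u : 'rV[R]_N -> R) :
  1 < p ->
  domain Om -> Om != setT ->
  rho = inradius Om -> (0 < rho)%E ->
  (0 < b)%E -> ((rho < +oo)%E -> (rho < b)%E) -> (rho = +oo%E -> b = +oo%E) ->
  bessel_pair p b V W -> positive_solution p b V W phi ->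
  test_function Om u ->
  let mu := lebesgue_rV N in
  let d := dist_boundary Om in
  let v := fun x => u x / phi (d x) in
  let psi := fun x => V (d x) * ppow p (derive1 phi (d x) / phi (d x)) * `|u x| `^ p in
  (\int[mu]_(x in Om) (V (d x) * enorm (grad u x) `^ p)%:E
     - \int[mu]_(x in Om) (W (d x) * `|u x| `^ p)%:E
   = \int[mu]_(x in Om) (V (d x) * Cp p (grad u x) (phi (d x) *: grad v x))%:E
     - laplacian_dist Om psi)%E
  /\
  (\int[mu]_(x in Om) (V (d x) * `|edot (grad d x) (grad u x)| `^ p)%:E
     - \int[mu]_(x in Om) (W (d x) * `|u x| `^ p)%:E
   = \int[mu]_(x in Om)
       (V (d x) * Cp p ((edot (grad d x) (grad u x))%:M : 'rV[R]_1)
                       ((phi (d x) * edot (grad d x) (grad v x))%:M))%:E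
     - laplacian_dist Om psi)%E.
Proof.
move=> p1 [_ oOm _] _ -> r0 _ rb rbo bp sol tu mu d v psi.
apply: (hardy_identities p1 oOm (boundary_nonempty r0) _ bp sol tu).
exact: dist_boundary_itv.
Qed.
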